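(* Let $\alpha>0$, $0<q<\infty$, $r>0$, let $\mu$ be a positive Borel measure on $\mathbb{C}$, and let $\{a_k\}_{k=1}^\infty$ be an $r$-lattice of $\mathbb{C}$. The following are equivalent: (1) $\mu$ is an $(\infty,q)$ Fock-Carleson measure; (2) $\tilde{\mu}_t\in L^1(\mathbb{C},dA)$ for every $t>0$; (3) the function $z\mapsto\mu(B(z,r))$ belongs to $L^1(\mathbb{C},dA)$; (4) $\{\mu(B(a_k,r))\}_{k\ge1}\in \ell^1$.
   Context: $dA$ is area measure on $\mathbb{C}$, $B(z,r)$ is the open disc of center $z$ and radius $r$. $F^\infty_\alpha$ is the space of entire functions $f$ with $\|f\|_{\infty,\alpha}=\sup_{z}|f(z)|e^{-\alpha|z|^2/2}<\infty$. $\mu$ is an $(\infty,q)$ Fock-Carleson measure if there is $C>0$ with $\left[\int_{\mathbb{C}}|f(z)e^{-\alpha|z|^2/2}|^q\,d\mu(z)\right]^{1/q}\le C\|f\|_{\infty,\alpha}$ for all $f\in F^\infty_\alpha$. For $t>0$, the $t$-Berezin transform of $\mu$ is $\tilde{\mu}_t(z)=\frac{\alpha}{\pi}\int_{\mathbb{C}}e^{-\alpha t|z-w|^2/2}\,d\mu(w)$. A sequence $\{a_k\}$ in $\mathbb{C}$ is an $r$-lattice if $\mathbb{C}=\bigcup_k B(a_k,r)$ and the discs $B(a_k,r/2)$ are pairwise disjoint. *)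

(* Defs.v *)
(* The complex plane C is modelled as
   the measurable space R * R (product of Borel sigma-algebras = Borel sets
   of R^2); values of entire functions live in mathcomp-real-closed's
   complex numbers R[i].  z = (x, y) corresponds to x + i y. *)
From HB Require Import structures.
From mathcomp Require Import all_boot all_order all_algebra.
From mathcomp Require Import all_classical all_reals all_analysis.
From mathcomp Require Import complex.
Set Implicit Arguments. Unset Strict Implicit. Unset Printing Implicit Defensive.
Import Order.TTheory GRing.Theory Num.Theory.
Import numFieldNormedType.Exports.
Local Open Scope classical_set_scope.
Local Open Scope ring_scope.

Section Fock.
Variable R : realType.

Definition toC (z : R * R) : R[i] := (z.1 +i* z.2)%C.

Definition cmod (z : R * R) : R := Num.sqrt (z.1 ^+ 2 + z.2 ^+ 2).

Definition cdist (z w : R * R) : R := cmod (z.1 - w.1, z.2 - w.2).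

Definition disc (z : R * R) (r : R) : set (R * R) := [set w | cdist w z < r].

Definition area := ((@lebesgue_measure R) \x (@lebesgue_measure R))%E.

Definition entire (f : R * R -> R[i]) : Prop :=
  forall z : R * R, exists d : R[i], forall e : R, 0 < e ->
    exists2 delta : R, 0 < delta & forall h : R * R,
      0 < cmod h < delta ->
      Normc.normc ((f (h.1 + z.1, h.2 + z.2) - f z) / toC h - d) < e.

Definition fock_weight (alpha : R) (z : R * R) : R :=
  expR (- (alpha * cmod z ^+ 2 / 2)).

Definition fock_inf_norm (alpha : R) (f : R * R -> R[i]) : \bar R :=
  ereal_sup [set (Normc.normc (f z) * fock_weight alpha z)%:E | z in [set: R * R]].

Definition in_Fock_inf (alpha : R) (f : R * R -> R[i]) : Prop :=
  entire f /\ (fock_inf_norm alpha f < +oo)%E.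

Definition Fock_Carleson_inf (alpha q : R)
    (mu : {measure set (R * R) -> \bar R}) : Prop :=
  exists2 C : R, 0 < C & forall f : R * R -> R[i], in_Fock_inf alpha f ->
    ((\int[mu]_z ((Normc.normc (f z) * fock_weight alpha z) `^ q)%:E) `^ (q^-1)
      <= C%:E * fock_inf_norm alpha f)%E.

Definition berezin (alpha t : R) (mu : {measure set (R * R) -> \bar R})
    (z : R * R) : \bar R :=
  ((alpha / pi)%:E * \int[mu]_w (expR (- (alpha * t * cdist z w ^+ 2 / 2)))%:E)%E.

Definition r_lattice (r : R) (a : nat -> R * R) : Prop :=
  (\bigcup_k disc (a k) r = [set: R * R]) /\
  (forall k l : nat, k <> l -> disc (a k) (r / 2) `&` disc (a l) (r / 2) = set0).

End Fock.

(* Main.v *)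
(** All four conditions are equivalent to [mu] having finite total mass.

    For (1), the function [cexp (alpha z^2 / 2 - 2 alpha b i z - alpha b^2)] has weighted
    modulus [exp (- alpha (Im z - b)^2)]: it is concentrated on the horizontal line
    [Im z = b].  A finite sum of such functions over lines at spacing [d], where
    [alpha d^2 = 100], is bounded by 7 in the Fock norm whatever the number of lines, and
    is bounded below on the strips of half-width [d / 4] around the lines.  Two families of
    such strips, shifted by [d / 2], exhaust the plane, so testing (1) on these
    theta-like sums bounds [mu] of the whole plane.

    For (2), Tonelli gives integrability of the Berezin transform of a finite measure, and
    the transform dominates a multiple of [mu (disc z r)].  For (3), averaging over a grid
    of squares of side [r / 2] bounds the total mass by the integral.  For (4), the lattice
    points are [r]-separated, so each such square contains at most one of them, and the disc
    around it is covered by 25 squares. *)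
Require Import Defs.
From HB Require Import structures.
From mathcomp Require Import all_boot all_order all_algebra.
From mathcomp Require Import all_classical all_reals all_analysis.
From mathcomp Require Import complex ring lra zify measurable_realfun.
Set Implicit Arguments.
Unset Strict Implicit.
Unset Printing Implicit Defensive.
Import Order.TTheory GRing.Theory Num.Theory.
Import numFieldNormedType.Exports.
Local Open Scope classical_set_scope.
Local Open Scope ring_scope.

(** * The complex exponential: Taylor estimate and entire functions built from it *)

Section ComplexExponential.
Variable R : realType.
Implicit Types (x y : R) (w : R[i]).
Import Normc.

Definition cexp w : R[i] :=
  (expR (complex.Re w) * cos (complex.Im w) +i* (expR (complex.Re w) * sin (complex.Im w)))%C.

Lemma cexpD w1 w2 : cexp (w1 + w2) = cexp w1 * cexp w2.
Proof.
case: w1 w2 => [a b] [c d]; rewrite /cexp /= expRD cosD sinD.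
by apply/eqP; rewrite eq_complex /=; apply/andP; split; apply/eqP; ring.
Qed.

Lemma normc_cexp w : normc (cexp w) = expR (complex.Re w).
Proof.
rewrite /cexp /= !exprMn -mulrDr cos2Dsin2 mulr1 sqrtr_sqr ger0_norm// expR_ge0.
Qed.

Lemma normc_ge0 w : 0 <= normc w.
Proof. by case: w => a b /=; exact: sqrtr_ge0. Qed.

Lemma ler_normcD w1 w2 : normc (w1 + w2) <= normc w1 + normc w2.
Proof. exact: (@le_normcD R w1 w2). Qed.

Lemma normc_opp w : normc (- w) = normc w.
Proof. exact: (@normcN R w). Qed.

Lemma normc_le_ReIm x y : normc (x +i* y)%C <= `|x| + `|y|.
Proof.
rewrite /= -[leRHS]ger0_norm ?addr_ge0// -[leRHS]sqrtr_sqr ler_wsqrtr//.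
rewrite sqrrD !real_normK ?num_real// -addrA lerD2l addrC lerDl.
by rewrite mulrn_wge0// mulr_ge0.
Qed.

Lemma normr_Re_le w : `|complex.Re w| <= normc w.
Proof.
by case: w => a b /=; rewrite -[leLHS]sqrtr_sqr ler_wsqrtr// lerDl sqr_ge0.
Qed.

Lemma normr_Im_le w : `|complex.Im w| <= normc w.
Proof.
by case: w => a b /=; rewrite -[leLHS]sqrtr_sqr ler_wsqrtr// lerDr sqr_ge0.
Qed.

(** The inequality [1 + y <= expR y] gives the sign at [y = x] and, at [y = - x], the bound
    [expR x <= 1 / (1 - x)]; then [1 / (1 - x) - 1 - x = x^2 / (1 - x)]. *)
Lemma expR_taylor1 x : `|x| <= 2^-1 -> `|expR x - 1 - x| <= 2 * x ^+ 2.
Proof.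
rewrite ler_norml => /andP[x1 x2].
have H := expR_ge1Dx x; have := expR_ge1Dx (- x); rewrite expRN => H'.
have E0 := expR_gt0 x.
have {H'} : (1 - x) * expR x <= 1.
  by rewrite -[leRHS](mulVf (lt0r_neq0 E0)) ler_wpM2r ?expR_ge0.
rewrite ger0_norm; last lra.
nra.
Qed.

Lemma normr_sin_le x : `|sin x| <= `|x|.
Proof.
wlog x0 : x / 0 <= x.
  move=> H; have [|/ltW] := leP 0 x; first exact: H.
  by rewrite -oppr_ge0 => /H; rewrite sinN !normrN.
have [|c _] := @MVT_segment R sin cos 0 x x0.
  by apply: continuous_subspaceT => y; exact: continuous_sin.
rewrite sin0 !subr0 => ->; rewrite normrM ler_piMl// ler_norml.
by rewrite cos_geN1 cos_le1.
Qed.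

Lemma normr_1Bcos_le x : `|1 - cos x| <= x ^+ 2.
Proof.
have -> : cos x = 1 - (sin (x / 2)) ^+ 2 *+ 2.
  rewrite {1}[x]splitr -mulr2n cos_mulr2n cos2sin2. ring.
rewrite subKr normrMn normrX.
have := normr_sin_le (x / 2); rewrite normrM (@ger0_norm _ 2^-1)// => H.
rewrite -[leRHS]real_normK ?num_real//; have x0 := normr_ge0 x.
have : `|sin (x / 2)| ^+ 2 <= (`|x| / 2) ^+ 2 by rewrite lerXn2r ?nnegrE ?divr_ge0.
rewrite expr_div_n; nra.
Qed.

(** By the mean value theorem [sin x - x = x (cos c - 1)] with [c] between 0 and [x], and
    [1 - cos c] is at most [c^2]. *)
Lemma normr_sinB_le x : `|x| <= 1 -> `|sin x - x| <= x ^+ 2.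
Proof.
wlog x0 : x / 0 <= x.
  move=> H; have [|/ltW] := leP 0 x; first exact: H.
  by rewrite -oppr_ge0 -(normrN x) => /H/[apply]; rewrite sinN -opprD normrN sqrrN.
rewrite (ger0_norm x0) => x1.
have [|c] := @MVT_segment R sin cos 0 x x0.
  by apply: continuous_subspaceT => y; exact: continuous_sin.
rewrite in_itv/= => /andP[c0 cx]; rewrite sin0 !subr0 => ->.
rewrite -{2}[x]mul1r -mulrBl normrM (ger0_norm x0) distrC.
have := normr_1Bcos_le c; nra.
Qed.

Lemma cexp_taylor1 w : normc w <= 2^-1 ->
  normc (cexp w - 1 - w) <= 8 * normc w ^+ 2.
Proof.
case: w => x y w1; have := normr_Re_le (x +i* y)%C; have := normr_Im_le (x +i* y)%C.
move: w1; set s := normc _ => s1 ys xs; rewrite /= in ys xs.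
(* Each summand is quadratically small: with [s] the modulus, the real part contributes
   [2 s^2 + 2 s^2] and the imaginary part [2 s^2 + s^2 + s^2], whence the constant 8. *)
have -> : cexp (x +i* y)%C - 1 - (x +i* y)%C =
   Complex ((expR x - 1 - x) * cos y - (1 + x) * (1 - cos y))
     ((expR x - 1 - x) * sin y + (sin y - y) + x * sin y).
  by apply/eqP; rewrite eq_complex /cexp/=; apply/andP; split; apply/eqP; ring.
have E := expR_taylor1 (le_trans xs s1).
have S : `|sin y - y| <= y ^+ 2 by apply: normr_sinB_le; rewrite (le_trans ys)//; lra.
have C := normr_1Bcos_le y; have S' := normr_sin_le y.
have x2 : x ^+ 2 <= s ^+ 2 by rewrite -(real_normK (num_real x)) lerXn2r ?nnegrE ?normc_ge0.
have y2 : y ^+ 2 <= s ^+ 2 by rewrite -(real_normK (num_real y)) lerXn2r ?nnegrE ?normc_ge0.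
have EM t : `|t| <= 1 -> `|(expR x - 1 - x) * t| <= 2 * s ^+ 2.
  by move=> t1; rewrite normrM; have := normr_ge0 (expR x - 1 - x); have := normr_ge0 t; nra.
have C1 : `|cos y| <= 1 by rewrite ler_norml cos_geN1 cos_le1.
have S1 : `|sin y| <= 1 by rewrite ler_norml sin_geN1 sin_le1.
have x1 : `|1 + x| <= 2 by rewrite (le_trans (ler_normD _ _))// normr1; lra.
have T1 : `|(1 + x) * (1 - cos y)| <= 2 * s ^+ 2.
  by rewrite normrM; have := normr_ge0 (1 - cos y); have := normr_ge0 (1 + x); nra.
have T2 : `|x * sin y| <= s ^+ 2.
  rewrite normrM expr2 ler_pM//; exact: le_trans ys.
rewrite (le_trans (normc_le_ReIm _ _))//.
rewrite (le_trans (lerD (ler_normB _ _)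
  (le_trans (ler_normD _ _) (lerD (ler_normD _ _) (lexx _)))))//.
have := EM _ C1; have := EM _ S1; lra.
Qed.

(* The exponent [P (z + h) - P z] factors as [h m] with [m] bounded, so [cexp_taylor1]
   gives a remainder of order [|h|^2]. *)
Lemma entire_cexp_quadratic (A B D : R[i]) :
  entire (fun z : R * R => cexp (A * toC z ^+ 2 + B * toC z + D)).
Proof.
move=> z; set Z := toC z; set P := A * Z ^+ 2 + B * Z + D.
set p := A *+ 2 * Z + B.
exists (cexp P * p) => e e0.
set M := normc p + normc A.
have M0 : 0 <= M by rewrite addr_ge0 ?normc_ge0.
set K := normc (cexp P) * (8 * M ^+ 2 + normc A).
have K0 : 0 <= K by rewrite mulr_ge0 ?addr_ge0 ?mulr_ge0 ?normc_ge0 ?sqr_ge0.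
(* The three bounds on [cmod h] give in turn [normc m <= M], [normc (H * m) <= 1/2] as
   [cexp_taylor1] requires, and [K * cmod h < e]. Adding 1 to [M] and [K] keeps the denominators
   positive. *)
exists (Num.min 1 (Num.min (2 * (M + 1))^-1 (e / (K + 1)))).
  by rewrite !lt_min ltr01 invr_gt0 mulr_gt0 ?divr_gt0 ?ltr_wpDl.
move=> h; rewrite !lt_min => /and4P[h0 h1 h2 h3].
set H := toC h.
have nH : normc H = cmod h by [].
have Hn0 : H != 0.
  by apply/eqP => HE; move: h0; rewrite -nH HE normc0 ltxx.
have -> : toC (h.1 + z.1, h.2 + z.2) = H + Z by [].
set m := p + A * H.
have -> : A * (H + Z) ^+ 2 + B * (H + Z) + D = P + H * m.
  by rewrite /P /m /p; ring.
rewrite cexpD.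
have mM : normc m <= M.
  rewrite (le_trans (ler_normcD _ _))// lerD2l normcM ler_piMr ?normc_ge0//.
  by rewrite nH ltW.
have Hm : normc (H * m) <= cmod h * M by rewrite normcM nH ler_wpM2l// ltW.
have Hm2 : normc (H * m) <= 2^-1.
  rewrite (le_trans Hm)//; move: h2; rewrite -[X in _ < X]div1r ltr_pdivlMr ?mulr_gt0 ?ltr_wpDl//.
  lra.
have -> : (cexp P * cexp (H * m) - cexp P) / H - cexp P * p =
   cexp P * ((cexp (H * m) - 1 - H * m) / H + A * H).
  by rewrite /m; field.
rewrite normcM.
have T : normc ((cexp (H * m) - 1 - H * m) / H + A * H) <=
    (8 * M ^+ 2 + normc A) * cmod h.
  rewrite (le_trans (ler_normcD _ _))// [leRHS]mulrDl !normcM normcV nH lerD2r.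
  rewrite ler_pdivrMr// (le_trans (cexp_taylor1 Hm2))//.
  have : normc (H * m) ^+ 2 <= (cmod h * M) ^+ 2.
    by rewrite lerXn2r ?nnegrE ?normc_ge0// mulr_ge0// ltW.
  by rewrite exprMn; lra.
rewrite (@le_lt_trans _ _ (K * cmod h))//.
  by rewrite /K -mulrA ler_wpM2l ?normc_ge0.
move: h3; rewrite ltr_pdivlMr ?ltr_wpDl//; lra.
Qed.

Lemma entireD (f g : R * R -> R[i]) :
  entire f -> entire g -> entire (fun z => f z + g z).
Proof.
move=> ef eg z; have [df Df] := ef z; have [dg Dg] := eg z.
exists (df + dg) => e e0; have e2 : 0 < e / 2 by rewrite divr_gt0.
have [d1 d10 D1] := Df (e / 2) e2.
have [d2 d20 D2] := Dg (e / 2) e2.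
exists (Num.min d1 d2) => [|h]; first by rewrite lt_min d10.
rewrite lt_min => /and3P[h0 h1 h2].
have := D1 h; rewrite h0 h1 => /(_ isT); have := D2 h; rewrite h0 h2 => /(_ isT).
set fh := f _; set gh := g _ => Lg Lf.
have -> : (fh + gh - (f z + g z)) / toC h - (df + dg) =
  ((fh - f z) / toC h - df) + ((gh - g z) / toC h - dg) by ring.
by rewrite (le_lt_trans (ler_normcD _ _))//; lra.
Qed.

Lemma entire0 : entire (fun=> 0 : R[i]).
Proof.
move=> z; exists 0 => e e0; exists 1 => // h _.
by rewrite !subr0 mul0r normc0.
Qed.

Lemma entire_sum (I : Type) (s : seq I) (F : I -> R * R -> R[i]) :
  (forall i, entire (F i)) -> entire (fun z => \sum_(i <- s) F i z).
Proof.
move=> eF; elim: s => [|i s IH].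
  have -> : (fun z => \sum_(i <- [::]) F i z) = (fun=> 0).
    by apply/funext => z; rewrite big_nil.
  exact: entire0.
have -> : (fun z => \sum_(j <- i :: s) F j z) = (fun z => F i z + \sum_(j <- s) F j z).
  by apply/funext => z; rewrite big_cons.
exact: entireD.
Qed.

Lemma ler_normc_sum (I : Type) (s : seq I) (P : pred I) (F : I -> R[i]) :
  normc (\sum_(i <- s | P i) F i) <= \sum_(i <- s | P i) normc (F i).
Proof.
elim/big_rec2 : _ => [|i x y _ IH]; first by rewrite normc0.
by rewrite (le_trans (ler_normcD _ _))// lerD2l.
Qed.

End ComplexExponential.

(** * Gaussian sums concentrated on equally spaced horizontal lines *)

Section ThetaSums.
Variable R : realType.
Implicit Types u v y c d alpha : R.
Import Normc.

(** The function [v / (1 + |v|)] is a bounded rational stand-in for the arctangent: its derivative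
    [1 / (1 + |v|)^2] is comparable to [1 / (1 + v^2)]. Bounding each term by an increment of it
    makes sums over unit steps telescope. *)
Lemma inv1Dsqr_le_telescope v :
  (1 + v ^+ 2)^-1 <= 7 / 2 * ((v + 1) / (1 + `|v + 1|) - v / (1 + `|v|)).
Proof.
have v2 : 0 < 1 + v ^+ 2 by rewrite ltr_wpDr ?sqr_ge0.
have key : forall a b : R, 0 < b -> 2 * b <= 7 * a * (1 + v ^+ 2) ->
    (1 + v ^+ 2)^-1 <= 7 / 2 * (a / b).
  move=> a b b0 H; have -> : 7 / 2 * (a / b) = 7 * a / (2 * b) by field; rewrite gt_eqF.
  by rewrite -div1r ler_pdivrMr// mulrAC ler_pdivlMr ?mulr_gt0// mul1r.
have [v0|v0] := leP 0 v.
  rewrite !ger0_norm ?addr_ge0//.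
  have -> : (v + 1) / (1 + (v + 1)) - v / (1 + v) = 1 / ((1 + (v + 1)) * (1 + v)).
    by field; rewrite !gt_eqF//; lra.
  by apply: key; have := sqr_ge0 (v - 1); nra.
rewrite (ltr0_norm v0); have [v1|v1] := leP 0 (v + 1).
  rewrite ger0_norm//.
  have -> : (v + 1) / (1 + (v + 1)) - v / (1 - v) =
      (1 - 2 * v - 2 * v ^+ 2) / ((1 + (v + 1)) * (1 - v)).
    by field; rewrite !gt_eqF//; lra.
  apply: key; first nra.
  have a1 : 1 <= 1 - 2 * v - 2 * v ^+ 2 by nra.
  by have := sqr_ge0 v; nra.
rewrite ltr0_norm//.
have -> : (v + 1) / (1 - (v + 1)) - v / (1 - v) = 1 / (- v * (1 - v)).
  field; apply/and3P; split; apply/eqP; lra.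
by apply: key; have := sqr_ge0 (v + 1); nra.
Qed.

Lemma sum_inv1Dsqr_le u (N : nat) : \sum_(n < N) (1 + (u - n%:R) ^+ 2)^-1 <= 7.
Proof.
pose G v := v / (1 + `|v|).
have G1 v : `|G v| <= 1.
  rewrite normrM normfV (@ger0_norm _ (1 + `|v|)) ?addr_ge0//.
  by rewrite ler_pdivrMr ?ltr_wpDr// mul1r lerDr.
(* As [G] takes values in [-1, 1], the telescoped sum is at most 7/2 times 2, whatever [N] is. *)
have H : \sum_(n < N) (1 + (u - n%:R) ^+ 2)^-1 <= 7 / 2 * (G (u + 1) - G (u + 1 - N%:R)).
  elim: N => [|N IH]; first by rewrite big_ord0 subr0 subrr mulr0.
  rewrite big_ord_recr/=; have := inv1Dsqr_le_telescope (u - N%:R).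
  have -> : u - N%:R + 1 = u + 1 - N%:R by ring.
  have -> : u + 1 - N.+1%:R = u - N%:R by rewrite -natr1; ring.
  by rewrite -!/(G _); move: IH; lra.
have := G1 (u + 1); have := G1 (u + 1 - N%:R); rewrite !ler_norml.
by move=> /andP[? ?] /andP[? ?]; lra.
Qed.

Lemma expRN_le_inv v : 0 <= v -> expR (- v) <= (1 + v)^-1.
Proof.
by move=> v0; rewrite expRN lef_pV2 ?posrE ?expR_gt0 ?ltr_wpDr// expR_ge1Dx.
Qed.

Lemma sum_gauss_le u (N : nat) : \sum_(n < N) expR (- (100 * (u - n%:R) ^+ 2)) <= 7.
Proof.
rewrite (le_trans _ (sum_inv1Dsqr_le u N))//; apply: ler_sum => n _.
have s0 := sqr_ge0 (u - n%:R).
apply: le_trans (expRN_le_inv _) _; first by rewrite mulr_ge0.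
by rewrite lef_pV2 ?posrE; move: s0; set t := _ ^+ 2; lra.
Qed.

(** For [n != m] the distance [v = u - n] satisfies [v^2 >= 9/16], so that
    [1 + 100 (v^2 - 1/16) >= 32 (1 + v^2)]. After the factor [expR (- (100 / 16))] is split off, the
    remaining sum is at most 7/32, below 1/2. *)
Lemma sum_gauss_off_peak_le u (N : nat) (m : 'I_N) : `|u - m%:R| <= 4^-1 ->
  \sum_(n < N | n != m) expR (- (100 * (u - n%:R) ^+ 2)) <= expR (- (100 / 16)) / 2.
Proof.
move=> um; apply: (@le_trans _ _ (\sum_(n < N)
    (expR (- (100 / 16)) / 32) * (1 + (u - n%:R) ^+ 2)^-1)); last first.
  rewrite -mulr_sumr; have := sum_inv1Dsqr_le u N; have := expR_ge0 (- (100 / 16) : R).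
  set E := expR _; set S := \sum_(_ < _) _; nra.
rewrite big_mkcond/=; apply: ler_sum => n _; case: ifPn => [nm|_]; last first.
  by rewrite mulr_ge0 ?divr_ge0 ?expR_ge0// invr_ge0 addr_ge0// sqr_ge0.
set v := u - n%:R.
have nm1 : 1 <= `|n%:R - m%:R : R|.
  have [h|h|h] := ltngtP n m; last by move: nm; rewrite -val_eqE/= h eqxx.
  - by rewrite ler0_norm ?subr_le0 ?ler_nat 1?ltnW// opprB lerBrDr nat1r ler_nat.
  - by rewrite ger0_norm ?subr_ge0 ?ler_nat 1?ltnW// lerBrDr nat1r ler_nat.
have v34 : 3 / 4 <= `|v|.
  have : `|n%:R - m%:R : R| <= `|u - m%:R| + `|v|.
    have -> : n%:R - m%:R = (u - m%:R) - v :> R by rewrite /v; ring.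
    exact: ler_normB.
  by lra.
have v2 : 9 / 16 <= v ^+ 2 by rewrite -(real_normK (num_real v)); nra.
have -> : - (100 * v ^+ 2) = - (100 / 16) + - (100 * (v ^+ 2 - 1 / 16)) by field.
rewrite expRD -mulrA ler_wpM2l ?expR_ge0//; apply: le_trans (expRN_le_inv _) _; first lra.
rewrite -[leRHS]invfM lef_pV2 ?posrE; lra.
Qed.

Definition strip_exp alpha (b : R) (z : R * R) : R[i] :=
  cexp (Complex (alpha / 2) 0 * toC z ^+ 2 + Complex 0 (- (2 * alpha * b)) * toC z
        + Complex (- (alpha * b ^+ 2)) 0).

(** The exponent has real part [alpha (x^2 - y^2) / 2 + 2 alpha b y - alpha b^2]; subtracting
    [alpha (x^2 + y^2) / 2] completes the square in [y] and removes [x]. *)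
Lemma weighted_strip_exp alpha (b : R) z :
  normc (strip_exp alpha b z) * fock_weight alpha z =
  expR (- (alpha * (z.2 - b) ^+ 2)).
Proof.
case: z => x y; rewrite /strip_exp normc_cexp /fock_weight -expRD; congr expR.
by rewrite /cmod /= sqr_sqrtr ?addr_ge0 ?sqr_ge0//=; field.
Qed.

Definition theta_sum alpha d c (N : nat) (z : R * R) : R[i] :=
  \sum_(n < N) strip_exp alpha (c + d * n%:R) z.

Lemma entire_theta_sum alpha d c N : entire (theta_sum alpha d c N).
Proof. by apply: entire_sum => n; exact: entire_cexp_quadratic. Qed.

(** The rescaled height [(z.2 - c) / d] sends the lines to the integers, which brings in the sums
    over [n] bounded above. *)
Lemma weighted_strip_expE alpha d c n z : d != 0 -> alpha * d ^+ 2 = 100 ->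
  normc (strip_exp alpha (c + d * n) z) * fock_weight alpha z =
  expR (- (100 * ((z.2 - c) / d - n) ^+ 2)).
Proof.
by move=> d0 <-; rewrite weighted_strip_exp; congr expR; field.
Qed.

Lemma fock_weight_ge0 alpha z : 0 <= fock_weight alpha z.
Proof. exact: expR_ge0. Qed.

Lemma weighted_theta_sum_le alpha d c N z : d != 0 -> alpha * d ^+ 2 = 100 ->
  normc (theta_sum alpha d c N z) * fock_weight alpha z <= 7.
Proof.
move=> d0 ad; rewrite (le_trans _ (sum_gauss_le ((z.2 - c) / d) N))//.
apply: le_trans (ler_wpM2r (fock_weight_ge0 _ _) (ler_normc_sum _ _ _)) _.
by rewrite mulr_suml ler_sum// => n _; rewrite weighted_strip_expE.
Qed.

(* Near the line [Im z = c + d m] the [m]-th term dominates all the others together. *)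
Lemma weighted_theta_sum_ge alpha d c N (m : 'I_N) z :
  0 < d -> alpha * d ^+ 2 = 100 -> `|z.2 - (c + d * m%:R)| <= d / 4 ->
  expR (- (100 / 16)) / 2 <=
  normc (theta_sum alpha d c N z) * fock_weight alpha z.
Proof.
move=> d0 ad zm; have dn0 := lt0r_neq0 d0; set u := (z.2 - c) / d.
have um : `|u - m%:R| <= 4^-1.
  have -> : u - m%:R = (z.2 - (c + d * m%:R)) / d by rewrite /u; field.
  by rewrite normrM normfV (gtr0_norm d0) ler_pdivrMr//; move: zm; set t := `|_|; lra.
have off := sum_gauss_off_peak_le um.
have peak : expR (- (100 / 16)) <= expR (- (100 * (u - m%:R) ^+ 2)).
  rewrite ler_expR lerN2 -(real_normK (num_real (u - m%:R))); have := normr_ge0 (u - m%:R).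
  by move: um; set t := `|_|; nra.
have tri : normc (strip_exp alpha (c + d * m%:R) z) <=
    normc (theta_sum alpha d c N z) +
    \sum_(n < N | n != m) normc (strip_exp alpha (c + d * n%:R) z).
  rewrite /theta_sum (bigD1 m)//=; set S := \sum_(_ < _ | _) strip_exp _ _ _.
  have := ler_normcD (strip_exp alpha (c + d * m%:R) z + S) (- S).
  rewrite addrK normc_opp => /le_trans; apply; rewrite lerD2l.
  exact: ler_normc_sum.
have := ler_wpM2r (fock_weight_ge0 alpha z) tri.
rewrite mulrDl mulr_suml (weighted_strip_expE _ _ _ dn0 ad) -/u.
under eq_bigr do rewrite (weighted_strip_expE _ _ _ dn0 ad) -/u.
by lra.
Qed.

Lemma in_Fock_theta_sum alpha d c N : d != 0 -> alpha * d ^+ 2 = 100 ->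
  (fock_inf_norm alpha (theta_sum alpha d c N) <= 7%:E)%E.
Proof.
move=> d0 ad; apply: ge_ereal_sup => _ [z _ <-].
by rewrite lee_fin weighted_theta_sum_le.
Qed.

End ThetaSums.

(** * Comparison of integrals of nonnegative functions with constants *)

Section IntegralBounds.
Context d (T : measurableType d) (R : realType).
Variable mu : {measure set T -> \bar R}.
Local Open Scope ereal_scope.

(** Each integral is a supremum over the nonnegative simple functions below the integrand, and a
    larger integrand admits more of them. *)
Lemma ge0_le_integralT (f g : T -> \bar R) :
  (forall x, 0 <= f x) -> (forall x, f x <= g x) ->
  \int[mu]_x f x <= \int[mu]_x g x.
Proof.
move=> f0 fg; rewrite !ge0_integralTE//; last by move=> x; exact: le_trans (fg x).
by apply: ereal_sup_le => _ [h hf <-]; exists h => // x; exact: le_trans (fg x).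
Qed.

Lemma integral_le_cst (f : T -> R) (M : R) :
  (forall x, (0 <= f x <= M)%R) -> \int[mu]_x (f x)%:E <= M%:E * mu [set: T].
Proof.
move=> fM; rewrite -integral_cst//; apply: ge0_le_integralT => x.
  by rewrite lee_fin; case/andP: (fM x).
by rewrite lee_fin; case/andP: (fM x).
Qed.

Lemma cst_le_integral (f : T -> R) (c : R) (E : set T) : measurable E ->
  (0 <= c)%R -> (forall x, (0 <= f x)%R) -> (forall x, E x -> (c <= f x)%R) ->
  c%:E * mu E <= \int[mu]_x (f x)%:E.
Proof.
move=> mE c0 f0 cf; rewrite -integral_cst// integral_mkcond.
apply: ge0_le_integralT => x; rewrite patchE; case: ifPn => // xE; rewrite lee_fin//.
by apply: cf; rewrite -inE.
Qed.

End IntegralBounds.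

(** * Fock-Carleson measures and finiteness of the total mass *)

Section CarlesonFinite.
Variable R : realType.
Implicit Types (mu : {measure set (R * R) -> \bar R}) (alpha q d p : R).
Import Normc.

Definition strip (b w : R) : set (R * R) := [set z | `|z.2 - b| <= w].

Lemma measurable_strip b w : measurable (strip b w).
Proof.
have mf : measurable_fun [set: R * R] (fun z : R * R => `|z.2 - b|).
  by apply: measurableT_comp => //; apply: measurable_funB.
have := mf measurableT _ (measurable_itv `]-oo, w]%R).
by rewrite setTI; congr measurable; apply/seteqP; split => z; rewrite /= in_itv.
Qed.

Lemma measurable_bigcup_strip d p (N : nat) :
  measurable (\bigcup_(n in `I_N) strip (p + d * n%:R) (d / 4)).
Proof. by apply: bigcup_measurable => n _; exact: measurable_strip. Qed.

(** Markov's inequality for [theta_sum]: its norm is at most 7 and its weighted modulus is at least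
    [k] on the strips. Neither bound involves [d], [p] or [N], so [K] is chosen before them. *)
Lemma Fock_Carleson_inf_strips alpha q mu : 0 < q ->
  Fock_Carleson_inf alpha q mu -> exists K : R, forall d p (N : nat),
    0 < d -> alpha * d ^+ 2 = 100 ->
    (mu (\bigcup_(n in `I_N) strip (p + d * n%:R) (d / 4)) <= K%:E)%E.
Proof.
move=> q0 [C C0 FC]; set k : R := expR (- (100 / 16)) / 2.
have k0 : 0 < k by rewrite divr_gt0 ?expR_gt0.
exists ((7 * C) `^ q / k `^ q) => d p N d0 ad.
have dn0 := lt0r_neq0 d0.
have norm7 := in_Fock_theta_sum p N dn0 ad.
have fI : in_Fock_inf alpha (theta_sum alpha d p N).
  by split; [exact: entire_theta_sum | exact: le_lt_trans norm7 (ltry _)].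
have {fI FC} := FC _ fI; set I := (\int[mu]_z _)%E => FC.
have I0 : (0 <= I)%E by apply: integral_ge0 => z _; rewrite lee_fin powR_ge0.
have {}FC : (I `^ q^-1 <= (7 * C)%:E)%E.
  by rewrite (le_trans FC)// mulrC EFinM lee_wpmul2l// lee_fin ltW.
have {}FC : (I <= ((7 * C) `^ q)%:E)%E.
  rewrite -(poweRe1 I0) -[X in (_ `^ X)%E](mulVf (lt0r_neq0 q0)) poweRrM -poweR_EFin.
  have C7 : 0 <= 7 * C by rewrite mulr_ge0// ltW.
  by apply: gt0_ler_poweR; rewrite ?in_itv/= ?leey ?poweR_ge0 ?lee_fin ?(ltW q0) ?C7.
rewrite EFinM muleC lee_pdivlMl ?powR_gt0//.
apply: le_trans FC; apply: cst_le_integral.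
- exact: measurable_bigcup_strip.
- exact: powR_ge0.
- by move=> z; exact: powR_ge0.
- move=> z [n /= nN zn]; apply: ge0_ler_powR; rewrite ?nnegrE ?(ltW q0) ?(ltW k0)//.
    by rewrite mulr_ge0 ?normc_ge0 ?fock_weight_ge0.
  exact: (@weighted_theta_sum_ge _ _ _ _ _ (Ordinal nN)).
Qed.

(** Starting [N] steps below [p], the [2N + 1] strips are those with integer index from [-N] to [N];
    these windows exhaust the integers. *)
Lemma bigcup_strips_int d p :
  \bigcup_N \bigcup_(n in `I_(N.*2.+1)) strip (p - d * N%:R + d * n%:R) (d / 4) =
  \bigcup_(k in [set: int]) strip (p + d * k%:~R) (d / 4).
Proof.
apply/seteqP; split => z.
  move=> [N _ [n _]]; rewrite /strip/= => H; exists (n%:Z - N%:Z) => //=.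
  by move: H; rewrite intrB !pmulrn mulrBr addrA addrAC.
move=> [k _ H]; exists (absz k) => //; exists (absz (k + (absz k)%:Z)) => /=; first lia.
move: H; rewrite /strip/=; congr (`|_ - _| <= _).
have -> : (absz (k + (absz k)%:Z))%:R = (k + (absz k)%:Z)%:~R :> R.
  by rewrite pmulrn; congr (_%:~R); lia.
by rewrite intrD -pmulrn; ring.
Qed.

Lemma nondecreasing_strips d p :
  nondecreasing_seq (fun N : nat =>
    \bigcup_(n in `I_(N.*2.+1)) strip (p - d * N%:R + d * n%:R) (d / 4)).
Proof.
move=> N M NM; apply/subsetPset => z [n /= nN H]; exists (n + (M - N))%N => /=.
  lia.
move: H; rewrite /strip/=; congr (`|_ - _| <= _).
by rewrite natrD natrB//; ring.
Qed.

(** The offset of [z.2] above the line [d k] ranges over a period of length [d]. Its first quarter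
    belongs to that line, the middle half to the shifted line, the last quarter to the line
    [k + 1]. *)
Lemma strips_cover d : 0 < d ->
  [set: R * R] `<=` \bigcup_(k in [set: int]) strip (0 + d * k%:~R) (d / 4) `|`
                    \bigcup_(k in [set: int]) strip (d / 2 + d * k%:~R) (d / 4).
Proof.
move=> d0 z _; set k := Num.floor (z.2 / d).
have k1 : d * k%:~R <= z.2.
  by rewrite mulrC -ler_pdivlMr// floor_le.
have k2 : z.2 < d * k%:~R + d.
  have := floorD1_gt (z.2 / d); rewrite -/k ltr_pdivrMr// intrD; lra.
have [h|h] := leP (z.2 - d * k%:~R) (d / 4).
  by left; exists k => //; rewrite /strip/= add0r ler_norml; apply/andP; split; lra.
have [h'|h'] := leP (z.2 - d * k%:~R) (3 * d / 4).
  by right; exists k => //; rewrite /strip/= ler_norml; apply/andP; split; lra.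
left; exists (k + 1) => //; rewrite /strip/= add0r ler_norml intrD mulrDr.
by apply/andP; split; lra.
Qed.

Lemma Fock_Carleson_inf_finite alpha q mu : 0 < alpha -> 0 < q ->
  Fock_Carleson_inf alpha q mu -> (mu [set: R * R] < +oo)%E.
Proof.
move=> a0 q0 /(Fock_Carleson_inf_strips q0)[K HK].
pose d := 10 / Num.sqrt alpha.
have d0 : 0 < d by rewrite divr_gt0 ?sqrtr_gt0.
have ad : alpha * d ^+ 2 = 100.
  by rewrite /d expr_div_n sqr_sqrtr ?ltW//; field; rewrite gt_eqF.
pose U p := \bigcup_(k in [set: int]) strip (p + d * k%:~R) (d / 4).
have mU p : measurable (U p).
  rewrite /U -bigcup_strips_int; apply: bigcupT_measurable => N.
  exact: measurable_bigcup_strip.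
(* Continuity from below along the increasing windows passes the uniform bound [K] to the infinite
   union. *)
have UK p : (mu (U p) <= K%:E)%E.
  have mE N := @measurable_bigcup_strip d (p - d * N%:R) N.*2.+1.
  have := @nondecreasing_cvg_mu _ _ _ mu _ mE (bigcupT_measurable _ mE)
    (@nondecreasing_strips d p).
  rewrite bigcup_strips_int -/(U p) => c; rewrite -(cvg_lim _ c)//.
  apply: lime_le; first by apply/cvg_ex; eexists; exact: c.
  by apply: nearW => N; exact: HK.
have := @le_measure _ _ _ mu [set: R * R] (U 0 `|` U (d / 2)).
rewrite !inE => /(_ measurableT (measurableU _ _ (mU _) (mU _))).
move=> /(_ (strips_cover d0)) /le_lt_trans; apply.
rewrite (le_lt_trans (measureU2 mu (mU _) (mU _)))//.
by rewrite (le_lt_trans (leeD (UK _) (UK _)))// ltry.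
Qed.

Lemma finite_Fock_Carleson_inf alpha q mu : 0 < q ->
  (mu [set: R * R] < +oo)%E -> Fock_Carleson_inf alpha q mu.
Proof.
move=> q0 muT; set m := fine (mu [set: R * R]).
have mE : mu [set: R * R] = m%:E by rewrite fineK// ge0_fin_numE.
have m0 : 0 <= m by rewrite fine_ge0.
(* The estimate holds with [m^(1/q)]; the added 1 keeps the constant positive when [mu] vanishes. *)
exists (m `^ q^-1 + 1) => [|f [_]]; first by rewrite ltr_wpDl ?powR_ge0.
set F := fock_inf_norm _ _ => Foo.
have FM z : ((normc (f z) * fock_weight alpha z)%:E <= F)%E.
  by apply: ereal_sup_ubound; exists z.
have F0 : (0 <= F)%E.
  by rewrite (le_trans _ (FM (0, 0)))// lee_fin mulr_ge0 ?normc_ge0 ?fock_weight_ge0.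
have [M FE M0] : exists2 M : R, F = M%:E & 0 <= M.
  by exists (fine F); rewrite ?fineK ?ge0_fin_numE// fine_ge0.
rewrite FE in FM *.
set I := (\int[mu]_z _)%E.
have I0 : (0 <= I)%E by apply: integral_ge0 => z _; rewrite lee_fin powR_ge0.
have IM : (I <= (M `^ q * m)%:E)%E.
  rewrite EFinM -mE; apply: integral_le_cst => z; rewrite powR_ge0/=.
  apply: ge0_ler_powR; rewrite ?nnegrE ?(ltW q0)//.
    by rewrite mulr_ge0 ?normc_ge0 ?fock_weight_ge0.
  by have := FM z; rewrite lee_fin.
apply: (@le_trans _ _ ((M `^ q * m)%:E `^ q^-1)%E).
  apply: gt0_ler_poweR; rewrite ?in_itv/= ?leey ?andbT ?lee_fin ?invr_ge0 ?(ltW q0)//.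
  by rewrite mulr_ge0 ?powR_ge0.
rewrite poweR_EFin powRM ?powR_ge0// -powRrM mulfV ?gt_eqF// powRr1//.
by rewrite lee_fin mulrDl mul1r mulrC lerDl.
Qed.

End CarlesonFinite.

(** * Squared distance and measurability of discs *)

Section PlaneDistance.
Variable R : realType.
Implicit Types (r c : R) (z w : R * R).

Definition sqdist z w : R := (z.1 - w.1) ^+ 2 + (z.2 - w.2) ^+ 2.

Lemma cdist_sqr z w : cdist z w ^+ 2 = sqdist z w.
Proof. by rewrite sqr_sqrtr// addr_ge0 ?sqr_ge0. Qed.

Lemma sqdistC z w : sqdist z w = sqdist w z.
Proof. by rewrite /sqdist; ring. Qed.

Lemma cdist_lt z w r : 0 < r -> (cdist z w < r) = (sqdist z w < r ^+ 2).
Proof.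
by move=> r0; rewrite -cdist_sqr ltr_pXn2r ?nnegrE ?sqrtr_ge0 ?(ltW r0).
Qed.

Lemma measurable_sqdist : measurable_fun [set: (R * R) * (R * R)] (fun p => sqdist p.1 p.2).
Proof.
by apply: measurable_funD; apply: measurable_funX; apply: measurable_funB;
  apply: measurableT_comp.
Qed.

Lemma measurable_sqdist_lt c :
  measurable [set p : (R * R) * (R * R) | sqdist p.1 p.2 < c].
Proof.
have := measurable_sqdist measurableT (measurable_itv `]-oo, c[%R).
by rewrite setTI; congr measurable; apply/seteqP; split => z; rewrite /= in_itv.
Qed.

(** Seeing all discs as sections of one measurable set yields both their measurability and, later,
    that of [z |-> mu (disc z r)]. *)
Lemma disc_xsection z r : 0 < r ->
  disc z r = xsection [set p : (R * R) * (R * R) | sqdist p.1 p.2 < r ^+ 2] z.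
Proof.
move=> r0; apply/seteqP; split => w; rewrite /xsection /disc /= inE /=.
  by rewrite cdist_lt// sqdistC.
by rewrite cdist_lt// sqdistC.
Qed.

Lemma measurable_disc z r : 0 < r -> measurable (disc z r).
Proof.
by move=> r0; rewrite disc_xsection//; apply: measurable_xsection; exact: measurable_sqdist_lt.
Qed.

End PlaneDistance.

(** * Square grids, and lattice sums compared with total mass *)

Section Grid.
Variable R : realType.
Implicit Types (s r : R) (z w : R * R).

Definition cell s z : int * int := (Num.floor (z.1 / s), Num.floor (z.2 / s)).

Definition tile s (k : int * int) : set (R * R) := [set z | cell s z = k].

(** Tiles are enumerated by the natural code of their integer pair; a number that codes no pair
    gives the empty set. *)
Definition tile_seq s (n : nat) : set (R * R) := [set z | pickle (cell s z) = n].

Lemma tileE s (k : int * int) : 0 < s ->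
  tile s k = [set` `[s * k.1%:~R, s * (k.1 + 1)%:~R[] `*`
             [set` `[s * k.2%:~R, s * (k.2 + 1)%:~R[].
Proof.
have fl x (i : int) : 0 < s ->
    (Num.floor (x / s) == i) = (x \in `[s * i%:~R, s * (i + 1)%:~R[).
  by move=> s0; rewrite floor_eq in_itv/= ler_pdivlMr// ltr_pdivrMr// !(mulrC s).
case: k => i j s0; apply/seteqP; split => -[x y]; rewrite /tile /cell /=.
  by case=> /eqP; rewrite fl// => xi /eqP; rewrite fl.
by case; rewrite -!fl// => /eqP -> /eqP ->.
Qed.

Lemma measurable_tile s k : 0 < s -> measurable (tile s k).
Proof. by move=> s0; rewrite tileE//; apply: measurableX; exact: measurable_itv. Qed.

Lemma area_tile s k : 0 < s -> @area R (tile s k) = (s ^+ 2)%:E.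
Proof.
move=> s0.
have len (i : int) : lebesgue_measure [set` `[s * i%:~R, s * (i + 1)%:~R[] = s%:E.
  rewrite lebesgue_measure_itv/= lte_fin ltr_pM2l// ltr_int ltzD1 lexx.
  by rewrite -EFinB; congr EFin; rewrite intrD; ring.
rewrite tileE// /area product_measure1E; try exact: measurable_itv.
by rewrite expr2 EFinM; congr (_ * _)%E; exact: len.
Qed.

Lemma tile_seqP s n : tile_seq s n = set0 \/ exists k, tile_seq s n = tile s k.
Proof.
have [->|/set0P[z zn]] := eqVneq (tile_seq s n) set0; [by left|right].
exists (cell s z); apply/seteqP; split => w; rewrite /tile_seq /tile/=.
  by rewrite -{1}zn => /(pcan_inj pickleK).
by move=> ->.
Qed.

Lemma measurable_tile_seq s n : 0 < s -> measurable (tile_seq s n).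
Proof.
by move=> s0; have [->|[k ->]] := tile_seqP s n; [exact: measurable0|exact: measurable_tile].
Qed.

Lemma bigcup_tile_seq s : \bigcup_n tile_seq s n = [set: R * R].
Proof. by apply/seteqP; split => // z _; exists (pickle (cell s z)). Qed.

Lemma trivIset_tile_seq s : trivIset [set: nat] (tile_seq s).
Proof. by move=> i j _ _ [z [<- <-]]. Qed.

Lemma sigma_finite_area : sigma_finite [set: R * R] (@area R).
Proof.
exists (tile_seq 1); first by rewrite bigcup_tile_seq.
move=> n; split; first exact: measurable_tile_seq.
have [->|[k ->]] := tile_seqP 1 n; last by rewrite area_tile ?ltry.
have -> : @area R set0 = 0%E by exact: measure0.
exact: ltry.
Qed.

Lemma cell_eq_lt s z w : 0 < s -> cell s z = cell s w ->
  `|z.1 - w.1| < s /\ `|z.2 - w.2| < s.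
Proof.
move=> s0; have fl x y : Num.floor (x / s) = Num.floor (y / s) -> `|x - y| < s.
  have xl := floor_le (x / s); have xr := floorD1_gt (x / s).
  have yl := floor_le (y / s); have yr := floorD1_gt (y / s).
  move=> E; move: xl xr yl yr; rewrite E intrD.
  rewrite !ler_pdivlMr// !ltr_pdivrMr// !mulrDl mul1r => *.
  by rewrite ltr_norml; apply/andP; split; lra.
by case=> /fl ? /fl ?.
Qed.

(* Each tile of side [r / 2] lies in the disc of radius [r] around any of its points, so
   averaging [mu (disc z r)] over the tiles recovers the total mass. *)
Lemma integrable_ge_disc_finite (mu : {measure set (R * R) -> \bar R}) r
    (g : R * R -> \bar R) : 0 < r ->
  (@area R).-integrable [set: R * R] g -> (forall z, mu (disc z r) <= g z)%E ->
  (mu [set: R * R] < +oo)%E.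
Proof.
move=> r0 /integrableP[mg goo] mug.
have s0 : 0 < r / 2 by rewrite divr_gt0.
set s := r / 2 in s0.
have g0 z : (0 <= g z)%E by exact: le_trans (mug z).
(* Points of one tile differ by less than [r / 2] in each coordinate, so their squared distance is
   below [r^2 / 2]. *)
have tile_le z : (mu (tile s (cell s z)) <= g z)%E.
  apply: le_trans (mug z); rewrite le_measure ?inE//; first exact: measurable_tile.
    exact: measurable_disc.
  move=> w /(cell_eq_lt s0)[h1 h2]; rewrite /disc/= cdist_lt// /sqdist.
  have := real_normK (num_real (w.1 - z.1)); have := real_normK (num_real (w.2 - z.2)).
  move: h1 h2; rewrite /s; set a := `|_|; set b := `|_| => h1 h2 <- <-.
  have a0 : 0 <= a by exact: normr_ge0.
  have b0 : 0 <= b by exact: normr_ge0.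
  nra.
have step n : ((s ^+ 2)%:E * mu (tile_seq s n) <= \int[@area R]_(z in tile_seq s n) g z)%E.
  have [->|[k kE]] := tile_seqP s n; first by rewrite measure0 mule0 integral_set0.
  rewrite kE muleC -(area_tile k s0) -integral_cst; last exact: measurable_tile.
  apply: ge0_le_integral => //; first exact: measurable_tile.
    by apply: measurable_funS mg.
  by move=> z <-; exact: tile_le.
have : ((s ^+ 2)%:E * mu [set: R * R] < +oo)%E.
  apply: le_lt_trans goo; under [leRHS]eq_integral do rewrite gee0_abs//.
  rewrite -(bigcup_tile_seq s) measure_semi_bigcup; last 3 first.
  - by move=> n; exact: measurable_tile_seq.
  - exact: trivIset_tile_seq.
  - by apply: bigcupT_measurable => n; exact: measurable_tile_seq.
  rewrite -nneseriesZl// ge0_integral_bigcup//; last 3 first.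
  - by move=> n; exact: measurable_tile_seq.
  - by rewrite bigcup_tile_seq.
  - exact: trivIset_tile_seq.
  by apply: lee_nneseries => n *; rewrite ?step// mule_ge0// lee_fin sqr_ge0.
apply: contraTT; rewrite -!leNgt !leye_eq => /eqP ->.
by rewrite gt0_muley// lte_fin exprn_gt0.
Qed.

(** For [m < 25] the base 5 digits of [m], lowered by 2, run through all offsets in {-2, ...,
    2}^2. *)
Definition shift_cell (k : int * int) (m : nat) : int * int :=
  (k.1 + (m %/ 5)%N%:Z - 2, k.2 + (m %% 5)%N%:Z - 2).

(** A coordinate moves by less than [r], that is two tile sides, so its floor moves by at most 2. *)
Lemma disc_sub_tiles r z : 0 < r ->
  disc z r `<=` \bigcup_(m in `I_25) tile (r / 2) (shift_cell (cell (r / 2) z) m).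
Proof.
move=> r0 w; rewrite /disc/= cdist_lt// /sqdist => wz.
have s0 : 0 < r / 2 by rewrite divr_gt0.
have fl x y : (x - y) ^+ 2 < r ^+ 2 -> exists2 i : nat, (i < 5)%N &
    Num.floor (x / (r / 2)) = Num.floor (y / (r / 2)) + i%:Z - 2.
  move=> xy.
  have /andP[xy1 xy2] : - r < x - y < r.
    by rewrite -ltr_norml -(ltr_pXn2r (ltn0Sn 1)) ?nnegrE ?(ltW r0)// real_normK// num_real.
  set X := Num.floor (x / _); set Y := Num.floor (y / _).
  have B (p q : int) : (p%:~R : R) < (q + 1)%:~R + 2 -> p <= q + 2.
    by rewrite -[2]/(2%:~R) -intrD ltr_int; lia.
  have xl := floor_le (x / (r / 2)); have xr := floorD1_gt (x / (r / 2)).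
  have yl := floor_le (y / (r / 2)); have yr := floorD1_gt (y / (r / 2)).
  have e1 : x / (r / 2) < y / (r / 2) + 2.
    by rewrite ltr_pdivrMr// mulrDl divfK ?gt_eqF//; lra.
  have e2 : y / (r / 2) < x / (r / 2) + 2.
    by rewrite ltr_pdivrMr// mulrDl divfK ?gt_eqF//; lra.
  have h1 : X <= Y + 2 by apply: B; rewrite -/X -/Y in xl yr *; lra.
  have h2 : Y <= X + 2 by apply: B; rewrite -/X -/Y in yl xr *; lra.
  by exists (absz (X - Y + 2)); clearbody X Y; clear -h1 h2; lia.
have [i i5 Ei] := fl w.1 z.1 ltac:(have := sqr_ge0 (z.2 - w.2); nra).
have [j j5 Ej] := fl w.2 z.2 ltac:(have := sqr_ge0 (z.1 - w.1); nra).
exists (i * 5 + j)%N => /=; first lia.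
rewrite /tile /shift_cell /cell/= Ei Ej divnMDl// modnMDl (divn_small j5) addn0.
by rewrite modn_small.
Qed.

(** Otherwise the midpoint of two lattice points in one tile would lie in both discs of radius
    [r / 2]. *)
Lemma r_lattice_cell_inj r (a : nat -> R * R) : 0 < r -> r_lattice r a ->
  injective (fun k => cell (r / 2) (a k)).
Proof.
move=> r0 [_ sep] k l /cell_eq_lt[|h1 h2]; first by rewrite divr_gt0.
have [//|/eqP kl] := eqVneq k l.
have r20 : 0 < r / 2 by rewrite divr_gt0.
pose m := (((a k).1 + (a l).1) / 2, ((a k).2 + (a l).2) / 2).
suff : (disc (a k) (r / 2) `&` disc (a l) (r / 2)) m by rewrite (sep _ _ kl).
move: h1 h2; rewrite !ltr_norml /disc /= !cdist_lt// /sqdist /m/=.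
by move=> /andP[? ?] /andP[? ?]; split; nra.
Qed.

Lemma finite_lattice_sum r (a : nat -> R * R) (mu : {measure set (R * R) -> \bar R}) :
  0 < r -> r_lattice r a -> (mu [set: R * R] < +oo)%E ->
  (\sum_(0 <= k <oo) mu (disc (a k) r) < +oo)%E.
Proof.
move=> r0 ar muT; have s0 : 0 < r / 2 by rewrite divr_gt0.
pose D m k := tile (r / 2) (shift_cell (cell (r / 2) (a k)) m).
have mD m k : measurable (D m k) by exact: measurable_tile.
(* For a fixed offset [m], distinct lattice points give distinct, hence disjoint, tiles. *)
have DT m : (\sum_(0 <= k <oo) mu (D m k) <= mu [set: R * R])%E.
  rewrite -measure_semi_bigcup//; last 2 first.
  - move=> k l _ _ [z [/= zk zl]]; apply: (r_lattice_cell_inj r0 ar) => /=.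
    move: zk; rewrite /D /tile/= zl; case: (cell _ (a k)) => i j; case: (cell _ (a l)) => i' j'.
    by rewrite /shift_cell /= => -[ii jj]; congr pair; lia.
  - exact: bigcupT_measurable.
  by rewrite le_measure ?inE//; exact: bigcupT_measurable.
apply: (@le_lt_trans _ _ (\sum_(0 <= k <oo) \sum_(m < 25) mu (D m k))%E).
  apply: lee_nneseries => // k *.
  apply: (@content_subadditive _ _ _ mu _ (D ^~ k)) => //; first exact: measurable_disc.
  by rewrite -(bigcup_mkord 25 (D ^~ k)); exact: disc_sub_tiles.
rewrite nneseries_sum//; apply: lte_sum_pinfty => m _.
exact: le_lt_trans (DT m) muT.
Qed.

Lemma lattice_sum_finite r (a : nat -> R * R) (mu : {measure set (R * R) -> \bar R}) :
  0 < r -> r_lattice r a -> (\sum_(0 <= k <oo) mu (disc (a k) r) < +oo)%E ->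
  (mu [set: R * R] < +oo)%E.
Proof.
move=> r0 [cov _]; apply: le_lt_trans; apply: measure_sigma_subadditive => //.
  by move=> k; exact: measurable_disc.
by rewrite cov.
Qed.

End Grid.

(** * Tonelli's theorem, Gaussian kernels and the Berezin transform *)

Section BerezinTransform.
Variable R : realType.
Implicit Types (mu : {measure set (R * R) -> \bar R}) (alpha t r c u : R) (z w : R * R).

(** Tonelli's theorem is stated for bundled sigma-finite measures; a proof of sigma-finiteness is
    packed here without changing the underlying function. *)
Lemma exists_sigma_finite_measure d (T : measurableType d) (mu : {measure set T -> \bar R}) :
  sigma_finite [set: T] mu ->
  exists nu : {sigma_finite_measure set T -> \bar R}, (nu : set T -> \bar R) = mu.
Proof.
move=> sigma.
pose H1 := isSFinite.Build _ _ _ _ (sfinite_measure_sigma_finite sigma).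
pose H2 := isSigmaFinite.Build _ _ _ _ sigma.
pose nu := HB.pack_for (SigmaFiniteMeasure.type T R) (Measure.sort mu) H1 H2.
by exists nu.
Qed.

Lemma exists_sigma_finite_product d1 d2 (T1 : measurableType d1) (T2 : measurableType d2)
    (m1 : {sigma_finite_measure set T1 -> \bar R})
    (m2 : {sigma_finite_measure set T2 -> \bar R}) :
  sigma_finite [set: T1 * T2] (m1 \x m2)%E ->
  exists m : {sigma_finite_measure set (T1 * T2)%type -> \bar R},
    (m : set (T1 * T2) -> \bar R) = (m1 \x m2)%E.
Proof.
exact: (@exists_sigma_finite_measure _ _
  (lebesgue_integral_fubini_product_measure1__canonical__measure_function_Measure m1 m2)).
Qed.

Lemma fubini_tonelli_product d1 d2 d3 (T1 : measurableType d1) (T2 : measurableType d2)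
    (T3 : measurableType d3) (m1 : {sigma_finite_measure set T1 -> \bar R})
    (m2 : {sigma_finite_measure set T2 -> \bar R})
    (nu : {sigma_finite_measure set T3 -> \bar R}) (f : (T1 * T2) * T3 -> \bar R) :
  sigma_finite [set: T1 * T2] (m1 \x m2)%E ->
  measurable_fun [set: (T1 * T2) * T3] f -> (forall p, 0 <= f p)%E ->
  (\int[m1 \x m2]_x \int[nu]_y f (x, y) = \int[nu]_y \int[m1 \x m2]_x f (x, y))%E.
Proof.
move=> /exists_sigma_finite_product[m mE] mf f0.
have := fubini_tonelli (m1 := m) (m2 := nu) f mf f0; rewrite -mE; exact: id.
Qed.

Lemma finite_sigma_finite d (T : measurableType d) (mu : {measure set T -> \bar R}) :
  (mu [set: T] < +oo)%E -> sigma_finite [set: T] mu.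
Proof.
move=> muT; apply: fin_num_fun_sigma_finite; first by rewrite measure0.
move=> A mA; rewrite ge0_fin_numE// (le_lt_trans _ muT)//.
by rewrite le_measure ?inE.
Qed.

(** The integrand is the normal density of mean [u] and variance [1 / (2c)] divided by its peak, and
    the peak does not depend on [u]. *)
Lemma integral_gauss_translate c : 0 < c -> exists G : R, forall u,
  (\int[lebesgue_measure]_x (expR (- (c * (x - u) ^+ 2)))%:E = G%:E)%E.
Proof.
move=> c0; pose s : R := Num.sqrt (2 * c)^-1.
have s0 : s != 0 by rewrite gt_eqF// sqrtr_gt0 invr_gt0 mulr_gt0.
exists (normal_peak s)^-1 => u.
rewrite -[RHS]mule1 -(integral_normal_pdf u s) -ge0_integralZl_EFin//; last 3 first.
- by move=> x _; rewrite lee_fin normal_pdf_ge0.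
- by apply/measurable_EFinP; exact: measurable_normal_pdf.
- by rewrite invr_ge0 normal_peak_ge0.
apply: eq_integral => x _; rewrite -EFinM normal_pdfE//=.
rewrite mulKf; last first.
  by rewrite gt_eqF// normal_peak_gt0.
congr (expR _)%:E.
by rewrite sqr_sqrtr ?invr_ge0 ?mulr_ge0 ?ltW//; field; rewrite gt_eqF.
Qed.

Definition gauss_kernel c (p : (R * R) * (R * R)) : \bar R :=
  (expR (- (c * sqdist p.1 p.2)))%:E.

Lemma measurable_gauss_kernel c : measurable_fun [set: (R * R) * (R * R)] (gauss_kernel c).
Proof.
apply/measurable_EFinP; apply: measurableT_comp => //; apply: measurableT_comp => //.
by apply: measurable_funM => //; exact: measurable_sqdist.
Qed.

Lemma gauss_kernel_ge0 c p : (0 <= gauss_kernel c p)%E.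
Proof. by rewrite lee_fin expR_ge0. Qed.

(** The kernel is a product of two one-dimensional Gaussians, so the value is the square of the
    integral on the line. *)
Lemma integral_area_gauss c : 0 < c -> exists G : R, forall w,
  (\int[@area R]_z gauss_kernel c (z, w) = G%:E)%E.
Proof.
move=> c0; have [G HG] := integral_gauss_translate c0.
exists (G * G) => w; rewrite /area fubini_tonelli1; last 2 first.
- apply: measurableT_comp; first exact: measurable_gauss_kernel.
  exact: measurable_pair2.
- by move=> z; exact: gauss_kernel_ge0.
have G0 : 0 <= G.
  by rewrite -lee_fin -(HG 0); apply: integral_ge0 => x _; rewrite lee_fin expR_ge0.
have mg u : measurable_fun [set: R] (fun x => (expR (- (c * (x - u) ^+ 2)))%:E).
  apply/measurable_EFinP; apply: measurableT_comp => //; apply: measurableT_comp => //.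
  by apply: measurable_funM => //; apply: measurable_funX; exact: measurable_funB.
rewrite EFinM -{1}(HG w.1) muleC -ge0_integralZl_EFin//; last exact: mg.
apply: eq_integral => x _; rewrite /fubini_F -(HG w.2) muleC.
rewrite -ge0_integralZl_EFin ?expR_ge0//; last exact: mg.
apply: eq_integral => y _; rewrite /gauss_kernel /sqdist/= -EFinM -expRD.
by congr (expR _)%:E; ring.
Qed.

Lemma berezinE alpha t mu z :
  berezin alpha t mu z =
  ((alpha / pi)%:E * \int[mu]_w gauss_kernel (alpha * t / 2) (z, w))%E.
Proof.
rewrite /berezin; congr (_ * _)%E; apply: eq_integral => w _.
by rewrite /gauss_kernel cdist_sqr; congr (expR _)%:E; field.
Qed.

Lemma finite_berezin_integrable alpha t mu : 0 < alpha -> 0 < t ->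
  (mu [set: R * R] < +oo)%E ->
  (@area R).-integrable [set: R * R] (berezin alpha t mu).
Proof.
move=> a0 t0 muT.
have [nu nuE] := exists_sigma_finite_measure (finite_sigma_finite muT).
have nuT : ((nu : set (R * R) -> \bar R) [set: R * R] < +oo)%E by rewrite nuE.
have c0 : 0 < alpha * t / 2 by rewrite divr_gt0 ?mulr_gt0.
set c := alpha * t / 2 in c0.
have [G HG] := integral_area_gauss c0.
have -> : berezin alpha t mu =
    (fun z => (alpha / pi)%:E * \int[nu]_w gauss_kernel c (z, w))%E.
  by apply/funext => z; rewrite berezinE nuE.
apply: integrableZl => //.
have mF := @measurable_fun_fubini_tonelli_F _ _ _ _ _ nu _
  (measurable_gauss_kernel c) (gauss_kernel_ge0 c).
apply/integrableP; split; first exact: mF.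
have F0 z : (0 <= \int[nu]_w gauss_kernel c (z, w))%E.
  by apply: integral_ge0 => w _; exact: gauss_kernel_ge0.
under eq_integral do rewrite (gee0_abs (F0 _)).
(* Integrated first in [z], the kernel gives the constant [G], so the double integral is [G] times
   the total mass. *)
rewrite [ltLHS](_ : _ = \int[nu]_w \int[@area R]_z gauss_kernel c (z, w))%E; last first.
  exact: (@fubini_tonelli_product _ _ _ _ _ _ (@lebesgue_measure R) (@lebesgue_measure R)
    nu (gauss_kernel c) (sigma_finite_area R) (measurable_gauss_kernel c)
    (gauss_kernel_ge0 c)).
under eq_integral do rewrite HG.
rewrite integral_cst// lte_mul_pinfty//.
by rewrite -(HG (0, 0)); apply: integral_ge0 => z _; exact: gauss_kernel_ge0.
Qed.

(** On the disc the kernel is at least [expR (- (alpha * r ^+ 2 / 2))]; the constant undoes this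
    factor and [alpha / pi]. *)
Lemma disc_le_berezin alpha r mu z : 0 < alpha -> 0 < r ->
  (mu (disc z r) <= (pi / alpha * expR (alpha * r ^+ 2 / 2))%:E * berezin alpha 1 mu z)%E.
Proof.
move=> a0 r0; rewrite berezinE.
set I := (\int[mu]_w _)%E.
have H : ((expR (- (alpha * r ^+ 2 / 2)))%:E * mu (disc z r) <= I)%E.
  apply: cst_le_integral => [||w|w]; rewrite ?expR_ge0//; first exact: measurable_disc.
  rewrite /disc/= cdist_lt// sqdistC => zw.
  by rewrite ler_expR lerN2; nra.
rewrite muleA -EFinM.
have cancel (p : R) : p != 0 -> p / alpha * expR (alpha * r ^+ 2 / 2) * (alpha / p) =
    expR (alpha * r ^+ 2 / 2).
  by move=> p0; field; rewrite p0 lt0r_neq0.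
rewrite cancel ?lt0r_neq0 ?pi_gt0//.
by rewrite -lee_pdivrMl ?expR_gt0// -expRN.
Qed.

Lemma finite_disc_integrable r mu : 0 < r -> (mu [set: R * R] < +oo)%E ->
  (@area R).-integrable [set: R * R] (fun z => mu (disc z r)).
Proof.
move=> r0 muT; have [nu nuE] := exists_sigma_finite_measure (finite_sigma_finite muT).
(* An auxiliary Berezin transform with both parameters 1 serves as the integrable majorant. *)
have bint := finite_berezin_integrable (@ltr01 R) (@ltr01 R) muT.
apply: (le_integrable _ _ _ (integrableZl measurableT (pi / 1 * expR (1 * r ^+ 2 / 2)) bint)) => //.
- rewrite -nuE; under eq_fun do rewrite disc_xsection//.
  exact: (measurable_fun_xsection nu (measurable_sqdist_lt (r ^+ 2))).
- move=> z _; rewrite gee0_abs//; apply: le_trans (disc_le_berezin mu z ltr01 r0) _.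
  exact: lee_abs.
Qed.

End BerezinTransform.

Theorem theorem2p6 (R : realType) (alpha q r : R)
  (mu : {measure set (R * R) -> \bar R}) (a : nat -> R * R) :
  0 < alpha -> 0 < q -> 0 < r -> r_lattice r a ->
  [<-> Fock_Carleson_inf alpha q mu;
       forall t : R, 0 < t -> (@area R).-integrable [set: R * R] (berezin alpha t mu);
       (@area R).-integrable [set: R * R] (fun z => mu (disc z r));
       (\sum_(0 <= k <oo) mu (disc (a k) r) < +oo)%E].
Proof.
move=> a0 q0 r0 ar; tfae.
- move=> /(Fock_Carleson_inf_finite a0 q0) muT t t0.
  exact: finite_berezin_integrable.
(* The case [t = 1] suffices: a multiple of that transform dominates [mu (disc z r)], which forces
   finite mass and thereby integrability. *)
- move=> /(_ _ ltr01) bint; apply: finite_disc_integrable => //.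
  pose K := pi / alpha * expR (alpha * r ^+ 2 / 2).
  apply: (integrable_ge_disc_finite r0 (integrableZl measurableT K bint)) => z.
  exact: disc_le_berezin.
- move=> dint; apply: finite_lattice_sum => //.
  exact: (integrable_ge_disc_finite r0 dint).
- move=> /(lattice_sum_finite r0 ar); exact: finite_Fock_Carleson_inf.
Qed.
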